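(* Let $g$ be a symmetric, non-singular type $(0,2)$ tensor field on $Q$ and let $L=\frac12g_{ij}u^iu^j$ on $TQ$. Let $J$ be a type $(1,1)$ tensor field on $Q$. If $J$ is symmetric with respect to $g$ (i.e. $g(JX,Y)=g(X,JY)$) and satisfies $$\nabla J=\tfrac12\left(\mathbf{T}\otimes d^Hf-X_f\otimes\theta_L\right)$$ for some function $f\in C^\infty(Q)$, then $N_J=0$ and $f=\mathrm{tr}\,J$; moreover, if $J$ is non-singular, then its cofactor tensor $A$ is a Killing tensor.
   Context: $Q$ is a smooth $n$-dimensional manifold, $\tau:TQ\to Q$ its tangent bundle with natural coordinates $(q^i,u^i)$; $|$ denotes the Levi-Civita covariant derivative of $g$. $\mathbf{T}=u^i\partial/\partial q^i$ is the canonical vector field along $\tau$. For a type $(1,1)$ tensor field $J$ on $Q$, the dynamical covariant derivative $\nabla J$ is the type $(1,1)$ tensor field along $\tau$ with components $(\nabla J)^i_j=J^i_{j|k}u^k$. $\theta_L$ is the 1-form along $\tau$ given by $\theta_L(X)=g(\mathbf{T},X)$; $d^Hf=\frac{\partial f}{\partial q^i}dq^i$; $X_f$ is the vector field with $g(X_f,Y)=-d^Hf(Y)$ for all $Y$. For a vector field $Z$ and 1-form $\alpha$ (along $\tau$), $Z\otimes\alpha$ is the type $(1,1)$ tensor $X\mapsto\alpha(X)Z$. (In coordinates the condition on $J$ reads $J^i_{j|k}=\frac12\big(\delta^i_k\frac{\partial f}{\partial q^j}+g^{il}\frac{\partial f}{\partial q^l}g_{jk}\big)$.) $N_J(X,Y)=[JX,JY]+J^2[X,Y]-J([JX,Y]+[X,JY])$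 is the Nijenhuis torsion. The cofactor tensor $A$ of $J$ is the type $(1,1)$ tensor field with $JA=(\det J)I$, where $I$ is the identity tensor. A type $(1,1)$ tensor field $A$ on $Q$ is a Killing tensor if the cyclic sum over $X,Y,Z$ of $g((D_XA)Y,Z)$ vanishes for all vector fields $X,Y,Z$ on $Q$, with $D$ the Levi-Civita connection of $g$; equivalently, the cyclic sum of $(D_X\tilde A)(Y,Z)$ vanishes, where $\tilde A(Y,Z)=g(AY,Z)$.
   Formalization: The claim f = tr J is proved only up to adding a locally constant function, since f enters the hypotheses only through its differential (J = 0 with f = 1 satisfies them but f ≠ tr J). *)

(* Defs.v *)
(* Smooth manifolds, tensor fields and the Levi-Civita connection, over
   MathComp-Analysis: tensor fields are families of component matrices, one for
   each chart of an atlas, related by the Jacobians of the changes of charts. *)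
From HB Require Import structures.
From mathcomp Require Import all_boot all_order all_algebra.
From mathcomp Require Import all_classical all_reals all_analysis.
Set Implicit Arguments.
Unset Strict Implicit.
Unset Printing Implicit Defensive.
Import Order.TTheory GRing.Theory Num.Theory.
Import numFieldNormedType.Exports.
Local Open Scope classical_set_scope.
Local Open Scope ring_scope.

(* [coord] and [param] are total functions; only [coord] on [dom] and [param]
   on the open set [coord @` dom], where they are inverse homeomorphisms,
   matter. *)
Record chart (R : realType) (n : nat) (M : topologicalType) := Chart {
  dom : set M;
  coord : M -> 'rV[R]_n;
  param : 'rV[R]_n -> M;
  dom_open : open dom;
  image_open : open (coord @` dom);
  coordK : forall p, dom p -> param (coord p) = p;
  coord_continuous : forall p, dom p -> {for p, continuous coord};
  param_continuous : forall p, dom p -> {for coord p, continuous param} }.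

(* [pd c i F p] is the partial derivative of F at p with respect to the i-th
   coordinate of the chart c. *)
Definition pd (R : realType) (n : nat) (M : topologicalType)
    (c : chart R n M) (i : 'I_n) (F : M -> R) (p : M) : R :=
  'D_(delta_mx 0 i) (F \o param c) (coord c p).

(* Class C^k on an open subset U of the domain of c: all the iterated partial
   derivatives of order at most k exist and are continuous. *)
Fixpoint Ck_on (R : realType) (n : nat) (M : topologicalType)
    (c : chart R n M) (U : set M) (k : nat) (F : M -> R) : Prop :=
  (forall p, U p -> {for p, continuous F}) /\
  if k is k'.+1 then
    forall i : 'I_n,
      (forall p, U p -> derivable (F \o param c) (coord c p) (delta_mx 0 i)) /\
      Ck_on c U k' (pd c i F)
  else True.

Definition smooth_on (R : realType) (n : nat) (M : topologicalType)
    (c : chart R n M) (U : set M) (F : M -> R) : Prop :=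
  forall k, Ck_on c U k F.

(* The atlas is not required to be maximal: any atlas determines the smooth
   structure. *)
Record manifold (R : realType) (n : nat) := Manifold {
  points :> topologicalType;
  points_hausdorff : hausdorff_space points;
  points_second_countable : @second_countable points;
  ix : Type;
  atlas : ix -> chart R n points;
  atlas_cover : forall p, exists a, dom (atlas a) p;
  atlas_smooth : forall (a b : ix) (i : 'I_n),
    smooth_on (atlas a) (dom (atlas a) `&` dom (atlas b))
      (fun p => coord (atlas b) p 0 i) }.

Definition at_chart (R : realType) (n : nat) (Q : manifold R n)
    (a : ix Q) (p : Q) : Prop := dom (atlas a) p.

Definition partial (R : realType) (n : nat) (Q : manifold R n)
    (a : ix Q) (i : 'I_n) (F : Q -> R) (p : Q) : R := pd (atlas a) i F p.

Definition smooth_in (R : realType) (n : nat) (Q : manifold R n)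
    (a : ix Q) (F : Q -> R) : Prop := smooth_on (atlas a) (dom (atlas a)) F.

Definition smooth_function (R : realType) (n : nat) (Q : manifold R n)
    (f : Q -> R) : Prop := forall a, smooth_in a f.

Definition jacobian (R : realType) (n : nat) (Q : manifold R n)
    (a b : ix Q) (p : Q) : 'M[R]_n :=
  \matrix_(i, j) partial a j (fun q => coord (atlas b) q 0 i) p.

(* The components of a field in the chart a are meaningful only at the points
   of the domain of a, and equality of fields is always stated there. *)
Definition vcomp (R : realType) (n : nat) (Q : manifold R n) : Type :=
  ix Q -> Q -> 'cV[R]_n.

Definition mcomp (R : realType) (n : nat) (Q : manifold R n) : Type :=
  ix Q -> Q -> 'M[R]_n.

Record vector_field (R : realType) (n : nat) (Q : manifold R n) := VectorField {
  vf_comp :> ix Q -> Q -> 'cV[R]_n;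
  vf_smooth : forall a i, smooth_in a (fun p => vf_comp a p i 0);
  vf_change : forall a b p, at_chart a p -> at_chart b p ->
    vf_comp b p = jacobian a b p *m vf_comp a p }.

(* The entry (i, j) is J^i_j, so that JX has components J *m X. *)
Record tensor11 (R : realType) (n : nat) (Q : manifold R n) := Tensor11 {
  t11_comp :> ix Q -> Q -> 'M[R]_n;
  t11_smooth : forall a i j, smooth_in a (fun p => t11_comp a p i j);
  t11_change : forall a b p, at_chart a p -> at_chart b p ->
    t11_comp b p *m jacobian a b p = jacobian a b p *m t11_comp a p }.

(* The entry (i, j) is g_ij. *)
Record tensor02 (R : realType) (n : nat) (Q : manifold R n) := Tensor02 {
  t02_comp :> ix Q -> Q -> 'M[R]_n;
  t02_smooth : forall a i j, smooth_in a (fun p => t02_comp a p i j);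
  t02_change : forall a b p, at_chart a p -> at_chart b p ->
    (jacobian a b p)^T *m t02_comp b p *m jacobian a b p = t02_comp a p }.

(* g(x, y), for tangent vectors x and y at p with components in the chart a. *)
Definition pairing (R : realType) (n : nat) (Q : manifold R n)
    (g : tensor02 Q) (a : ix Q) (p : Q) (x y : 'cV[R]_n) : R :=
  (x^T *m g a p *m y) 0 0.

Definition symmetric02 (R : realType) (n : nat) (Q : manifold R n)
    (g : tensor02 Q) : Prop :=
  forall a p, at_chart a p ->
    forall x y, pairing g a p x y = pairing g a p y x.

Definition nonsingular (R : realType) (n : nat) (Q : manifold R n)
    (t : mcomp Q) : Prop :=
  forall a p, at_chart a p -> t a p \in unitmx.

Definition g_symmetric (R : realType) (n : nat) (Q : manifold R n)
    (g : tensor02 Q) (J : tensor11 Q) : Prop :=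
  forall a p, at_chart a p -> forall x y,
    pairing g a p (J a p *m x) y = pairing g a p x (J a p *m y).

(* Gamma^i_jk = 1/2 g^il (d_j g_lk + d_k g_lj - d_l g_jk). *)
Definition christoffel (R : realType) (n : nat) (Q : manifold R n)
    (g : tensor02 Q) (a : ix Q) (p : Q) (i j k : 'I_n) : R :=
  2^-1 * \sum_l invmx (g a p) i l *
    (partial a j (fun q => g a q l k) p + partial a k (fun q => g a q l j) p
     - partial a l (fun q => g a q j k) p).

(* The entry (i, j) is A^i_(j|k) =
   d_k A^i_j + Gamma^i_kl A^l_j - Gamma^l_kj A^i_l. *)
Definition covariant_derivative (R : realType) (n : nat) (Q : manifold R n)
    (g : tensor02 Q) (A : tensor11 Q) (k : 'I_n) : mcomp Q :=
  fun a p => \matrix_(i, j)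
    (partial a k (fun q => A a q i j) p
     + \sum_l christoffel g a p i k l * A a p l j
     - \sum_l christoffel g a p l k j * A a p i l).

Definition covariant_derivative_along (R : realType) (n : nat)
    (Q : manifold R n) (g : tensor02 Q) (X : vector_field Q) (A : tensor11 Q) :
    mcomp Q :=
  fun a p => \sum_k X a p k 0 *: covariant_derivative g A k a p.

(* A field along the tangent bundle projection tau depends on a tangent vector
   at a point p; in the chart a, such a vector is the column u of its
   components. *)
Definition canonical_vector (R : realType) (n : nat) (u : 'cV[R]_n) : 'cV[R]_n :=
  u.

Definition dynamical_covariant_derivative (R : realType) (n : nat)
    (Q : manifold R n) (g : tensor02 Q) (J : tensor11 Q)
    (a : ix Q) (p : Q) (u : 'cV[R]_n) : 'M[R]_n :=
  \matrix_(i, j) \sum_k covariant_derivative g J k a p i j * u k 0.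

(* theta_L(X) = g(T, X), for L = 1/2 g_ij u^i u^j. *)
Definition theta (R : realType) (n : nat) (Q : manifold R n)
    (g : tensor02 Q) (a : ix Q) (p : Q) (u : 'cV[R]_n) : 'rV[R]_n :=
  (canonical_vector u)^T *m g a p.

Definition dH (R : realType) (n : nat) (Q : manifold R n)
    (f : Q -> R) (a : ix Q) (p : Q) : 'rV[R]_n :=
  \row_j partial a j f p.

(* Z is the vector field X_f: g(Z, Y) = - d^H f (Y). *)
Definition is_X_of (R : realType) (n : nat) (Q : manifold R n)
    (g : tensor02 Q) (f : Q -> R) (Z : vector_field Q) : Prop :=
  forall a p, at_chart a p -> forall y : 'cV[R]_n,
    pairing g a p (Z a p) y = - (dH f a p *m y) 0 0.

Definition tensor_product (R : realType) (n : nat)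
    (z : 'cV[R]_n) (alpha : 'rV[R]_n) : 'M[R]_n := z *m alpha.

Definition apply11 (R : realType) (n : nat) (Q : manifold R n)
    (J : tensor11 Q) (X : vcomp Q) : vcomp Q := fun a p => J a p *m X a p.

Definition vadd (R : realType) (n : nat) (Q : manifold R n)
    (X Y : vcomp Q) : vcomp Q := fun a p => X a p + Y a p.

Definition vsub (R : realType) (n : nat) (Q : manifold R n)
    (X Y : vcomp Q) : vcomp Q := fun a p => X a p - Y a p.

Definition lie_bracket (R : realType) (n : nat) (Q : manifold R n)
    (X Y : vcomp Q) : vcomp Q :=
  fun a p => \col_i \sum_k
    (X a p k 0 * partial a k (fun q => Y a q i 0) p
     - Y a p k 0 * partial a k (fun q => X a q i 0) p).

Definition nijenhuis (R : realType) (n : nat) (Q : manifold R n)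
    (J : tensor11 Q) (X Y : vcomp Q) : vcomp Q :=
  vsub
    (vadd (lie_bracket (apply11 J X) (apply11 J Y))
          (apply11 J (apply11 J (lie_bracket X Y))))
    (apply11 J (vadd (lie_bracket (apply11 J X) Y)
                     (lie_bracket X (apply11 J Y)))).

Definition is_cofactor (R : realType) (n : nat) (Q : manifold R n)
    (J A : tensor11 Q) : Prop :=
  forall a p, at_chart a p -> J a p *m A a p = (\det (J a p))%:M.

Definition is_killing (R : realType) (n : nat) (Q : manifold R n)
    (g : tensor02 Q) (A : tensor11 Q) : Prop :=
  forall (X Y Z : vector_field Q) a p, at_chart a p ->
    let term (U V W : vector_field Q) :=
      pairing g a p (covariant_derivative_along g U A a p *m V a p) (W a p) in
    term X Y Z + term Y Z X + term Z X Y = 0.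

Definition locally_constant (R : realType) (T : topologicalType)
    (c : T -> R) : Prop :=
  forall p, \forall q \near p, c q = c p.

(* Main.v *)
Require Import Defs.
From mathcomp Require Import all_boot all_order all_algebra.
From mathcomp Require Import all_classical all_reals all_analysis.
From mathcomp Require Import ring lra.
Import Order.TTheory GRing.Theory Num.Theory.
Import numFieldNormedType.Exports.
Local Open Scope ring_scope.
Set Implicit Arguments.
Unset Strict Implicit.
Unset Printing Implicit Defensive.

(** Only first derivatives occur, so all three conclusions come down to
identities between matrices at one point of one chart.  Write [D_u] for the
derivative in the direction [u] and [nabla_u] for the covariant derivative; on
type (1,1) fields [nabla_u J = D_u J + G_u J - J G_u], where [G_u] is the
matrix of Christoffel symbols contracted with [u] ([nablaE]).  The hypothesis
says [nabla_u J v = 1/2 ((df v) u - g(u, v) X_f)].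

- Torsion.  The product rule leaves only first derivatives of [J] in
  [nijenhuis], and as [G_u v] is symmetric in [u] and [v], they may be replaced
  by covariant ones ([nijenhuis_nabla]):
  [N_J(X,Y) = (nabla_JX J) Y - (nabla_JY J) X
              + J ((nabla_Y J) X - (nabla_X J) Y)].
  With the formula for [nabla J], the multiples of [JX], [JY] and [X_f] cancel,
  those of [X_f] because [g(JX, Y) = g(JY, X)].

- Trace.  Taking traces kills the commutator with [G_u], and
  [g(X_f, u) = - df u], so [d (tr J) = df].  The trace is chart independent
  because the Jacobians of the changes of charts are invertible, which the
  transformation law of a nonsingular [g] gives ([jacobian_unit]).  A function
  with zero partial derivatives is locally constant, by the mean value theorem
  applied to one coordinate at a time ([constant_on_ball]).

- Cofactor.  Differentiating [J A = (det J) I] and using the Jacobi formula for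
  [D_u (det J)] ([along_det]) gives [J nabla_u A = tr (nabla_u J A) I
  - nabla_u J A] ([nabla_cofactor]).  With [h(x, y) = g(J^-1 x, y)], which is
  symmetric, and [psi(x) = df (J^-1 x)], this becomes
  [g((nabla_u A) v, w) = det J (psi(u) h(v, w) - 1/2 psi(v) h(u, w)
  - 1/2 psi(w) h(u, v))], whose cyclic sum is zero. *)

(** * Matrix identities *)

Lemma addmxE (R : nmodType) (m n : nat) (B C : 'M[R]_(m, n)) i j :
  (B + C) i j = B i j + C i j.
Proof. exact: mxE. Qed.

Lemma oppmxE (R : zmodType) (m n : nat) (B : 'M[R]_(m, n)) i j :
  (- B) i j = - B i j.
Proof. exact: mxE. Qed.

Lemma scalemxE (R : pzSemiRingType) (m n : nat) (x : R) (B : 'M[R]_(m, n)) i j :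
  (x *: B) i j = x * B i j.
Proof. exact: mxE. Qed.

Lemma bilinear_eq (R : nzRingType) (m n : nat) (B C : 'M[R]_(m, n)) :
  (forall (x : 'cV_m) (y : 'cV_n), (x^T *m B *m y) 0 0 = (x^T *m C *m y) 0 0) ->
  B = C.
Proof.
move=> BC; apply/matrixP => i j.
have := BC (delta_mx i 0) (delta_mx j 0).
by rewrite !trmx_delta -!rowE -!colE !mxE.
Qed.

Lemma mx11_tr (R : nzRingType) (x : 'M[R]_1) : x^T = x.
Proof. by apply/matrixP => i j; rewrite mxE !ord1. Qed.

(** * Derivatives in a chart *)

Definition pdiff (R : realType) (n : nat) (M : topologicalType)
    (c : chart R n M) (F : M -> R) (p : M) : Prop :=
  forall k : 'I_n, derivable (F \o param c) (Defs.coord c p) (delta_mx 0 k).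

(** A combination of partial derivatives and not a directional derivative: for
functions that merely have partial derivatives, as in [pdiff], the two could
differ, and the combination is the one that is linear in the direction [u]. *)
Definition along (R : realType) (n : nat) (M : topologicalType)
    (c : chart R n M) (u : 'cV[R]_n) (F : M -> R) (p : M) : R :=
  \sum_k u k 0 * pd c k F p.

Lemma smooth_on_pdiff (R : realType) (n : nat) (M : topologicalType)
    (c : chart R n M) (U : set M) (F : M -> R) (p : M) :
  smooth_on c U F -> U p -> pdiff c F p.
Proof. by move=> /(_ 1%N) [_ dF] Up k; exact: (dF k).1. Qed.

Lemma nbhs_image (R : realType) (n : nat) (M : topologicalType)
    (c : chart R n M) (p : M) :
  dom c p -> nbhs (Defs.coord c p) (Defs.coord c @` dom c)%classic.
Proof.
by move=> cp; apply: open_nbhs_nbhs; split; [exact: image_open | exists p].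
Qed.

(** A partial derivative only sees the function on the domain of the chart,
since the image of that domain is open.  This is what allows identities that
hold on the domain alone, such as the symmetry of [g], to be differentiated. *)
Lemma pd_local (R : realType) (n : nat) (M : topologicalType)
    (c : chart R n M) (k : 'I_n) (F G : M -> R) (p : M) :
  (forall q, dom c q -> F q = G q) -> dom c p -> pd c k F p = pd c k G p.
Proof.
move=> FG cp; apply: near_eq_derive.
apply: filterS (nbhs_image cp) => _ [q cq <-] /=.
by rewrite coordK // FG.
Qed.

Lemma along_local (R : realType) (n : nat) (M : topologicalType)
    (c : chart R n M) (u : 'cV[R]_n) (F G : M -> R) (p : M) :
  (forall q, dom c q -> F q = G q) -> dom c p -> along c u F p = along c u G p.
Proof. by move=> FG cp; apply: eq_bigr => k _; rewrite (pd_local _ FG cp). Qed.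

Lemma pdiff_cst (R : realType) (n : nat) (M : topologicalType)
    (c : chart R n M) (x : R) (p : M) : pdiff c (fun=> x) p.
Proof. by move=> k; exact: derivable_cst. Qed.

Lemma along_cst (R : realType) (n : nat) (M : topologicalType)
    (c : chart R n M) (u : 'cV[R]_n) (x : R) (p : M) :
  along c u (fun=> x) p = 0.
Proof.
by rewrite /along big1 // => k _; rewrite /pd [X in _ * X]derive_cst mulr0.
Qed.

Lemma pdiffD (R : realType) (n : nat) (M : topologicalType)
    (c : chart R n M) (F G : M -> R) (p : M) :
  pdiff c F p -> pdiff c G p -> pdiff c (fun q => F q + G q) p.
Proof. by move=> dF dG k; exact: (derivableD (dF k) (dG k)). Qed.

Lemma alongD (R : realType) (n : nat) (M : topologicalType)
    (c : chart R n M) (u : 'cV[R]_n) (F G : M -> R) (p : M) :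
  pdiff c F p -> pdiff c G p ->
  along c u (fun q => F q + G q) p = along c u F p + along c u G p.
Proof.
move=> dF dG; rewrite /along -big_split; apply: eq_bigr => k _ /=.
by rewrite -mulrDr /pd -(deriveD (dF k) (dG k)).
Qed.

Lemma pdiffM (R : realType) (n : nat) (M : topologicalType)
    (c : chart R n M) (F G : M -> R) (p : M) :
  pdiff c F p -> pdiff c G p -> pdiff c (fun q => F q * G q) p.
Proof. by move=> dF dG k; exact: (derivableM (dF k) (dG k)). Qed.

Lemma alongM (R : realType) (n : nat) (M : topologicalType)
    (c : chart R n M) (u : 'cV[R]_n) (F G : M -> R) (p : M) :
  dom c p -> pdiff c F p -> pdiff c G p ->
  along c u (fun q => F q * G q) p
  = along c u F p * G p + F p * along c u G p.
Proof.
move=> cp dF dG; rewrite /along mulr_suml mulr_sumr -big_split.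
apply: eq_bigr => k _ /=; rewrite /pd.
have /= -> := (deriveM (dF k) (dG k)).
rewrite coordK// /GRing.scale /= mulrDr addrC; congr (_ + _).
  by rewrite mulrCA.
by rewrite mulrCA mulrC.
Qed.

Lemma pdiff_sum (R : realType) (n : nat) (M : topologicalType)
    (c : chart R n M) (I : Type) (r : seq I) (F : I -> M -> R) (p : M) :
  (forall i, pdiff c (F i) p) -> pdiff c (fun q => \sum_(i <- r) F i q) p.
Proof.
move=> dF; elim: r => [|i r IHr].
  have -> : (fun q => \sum_(i <- [::]) F i q) = (fun=> 0).
    by apply/funext => q; rewrite big_nil.
  exact: pdiff_cst.
have -> : (fun q => \sum_(j <- i :: r) F j q)
          = (fun q => F i q + \sum_(j <- r) F j q).
  by apply/funext => q; rewrite big_cons.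
exact: pdiffD.
Qed.

Lemma along_sum (R : realType) (n : nat) (M : topologicalType)
    (c : chart R n M) (u : 'cV[R]_n) (I : Type) (r : seq I) (F : I -> M -> R)
    (p : M) :
  (forall i, pdiff c (F i) p) ->
  along c u (fun q => \sum_(i <- r) F i q) p = \sum_(i <- r) along c u (F i) p.
Proof.
move=> dF; elim: r => [|i r IHr].
  rewrite big_nil -[RHS](along_cst c u 0 p); congr along.
  by apply/funext => q; rewrite big_nil.
rewrite big_cons -IHr -alongD //; last exact: pdiff_sum.
by congr along; apply/funext => q; rewrite big_cons.
Qed.

Lemma pdiff_prod (R : realType) (n : nat) (M : topologicalType)
    (c : chart R n M) (I : Type) (r : seq I) (F : I -> M -> R) (p : M) :
  (forall i, pdiff c (F i) p) -> pdiff c (fun q => \prod_(i <- r) F i q) p.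
Proof.
move=> dF; elim: r => [|i r IHr].
  have -> : (fun q => \prod_(i <- [::]) F i q) = (fun=> 1).
    by apply/funext => q; rewrite big_nil.
  exact: pdiff_cst.
have -> : (fun q => \prod_(j <- i :: r) F j q)
          = (fun q => F i q * \prod_(j <- r) F j q).
  by apply/funext => q; rewrite big_cons.
exact: pdiffM.
Qed.

Lemma along_prod (R : realType) (n : nat) (M : topologicalType)
    (c : chart R n M) (u : 'cV[R]_n) (I : eqType) (r : seq I) (F : I -> M -> R)
    (p : M) :
  dom c p -> (forall i, pdiff c (F i) p) -> uniq r ->
  along c u (fun q => \prod_(i <- r) F i q) p
  = \sum_(k <- r) \prod_(i <- r) (if i == k then along c u (F i) p else F i p).
Proof.
move=> cp dF; elim: r => [_|i r IHr /= /andP[ir Ur]].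
  rewrite big_nil -[RHS](along_cst c u 1 p); congr along.
  by apply/funext => q; rewrite big_nil.
have -> : (fun q => \prod_(j <- i :: r) F j q)
          = (fun q => F i q * \prod_(j <- r) F j q).
  by apply/funext => q; rewrite big_cons.
rewrite alongM //; last exact: pdiff_prod.
rewrite big_cons big_cons eqxx IHr //; congr (_ * _ + _).
  rewrite [LHS]big_seq [RHS]big_seq; apply: eq_bigr => j jr.
  by case: eqP ir => // <-; rewrite jr.
rewrite mulr_sumr [LHS]big_seq [RHS]big_seq; apply: eq_bigr => k kr.
by rewrite big_cons; case: eqP ir => // ->; rewrite kr.
Qed.

Lemma along_delta (R : realType) (n : nat) (M : topologicalType)
    (c : chart R n M) (k : 'I_n) (F : M -> R) (p : M) :
  along c (delta_mx k 0) F p = pd c k F p.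
Proof.
rewrite /along (bigD1 k) //= mxE !eqxx mul1r big1 ?addr0 // => l /negbTE lk.
by rewrite mxE lk mul0r.
Qed.

Definition mx_pdiff (R : realType) (n : nat) (M : topologicalType)
    (c : chart R n M) (m1 m2 : nat) (F : M -> 'M[R]_(m1, m2)) (p : M) : Prop :=
  forall i j, pdiff c (fun q => F q i j) p.

Definition mx_along (R : realType) (n : nat) (M : topologicalType)
    (c : chart R n M) (u : 'cV[R]_n) (m1 m2 : nat) (F : M -> 'M[R]_(m1, m2))
    (p : M) : 'M[R]_(m1, m2) :=
  \matrix_(i, j) along c u (fun q => F q i j) p.

Lemma mx_along_local (R : realType) (n : nat) (M : topologicalType)
    (c : chart R n M) (u : 'cV[R]_n) (m1 m2 : nat) (F G : M -> 'M[R]_(m1, m2))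
    (p : M) :
  (forall q, dom c q -> F q = G q) -> dom c p ->
  mx_along c u F p = mx_along c u G p.
Proof.
move=> FG cp; apply/matrixP => i j; rewrite !mxE; apply: along_local => // q cq.
by rewrite FG.
Qed.

Lemma mx_alongM (R : realType) (n : nat) (M : topologicalType)
    (c : chart R n M) (u : 'cV[R]_n) (m1 m2 m3 : nat)
    (F : M -> 'M[R]_(m1, m2)) (G : M -> 'M[R]_(m2, m3)) (p : M) :
  dom c p -> mx_pdiff c F p -> mx_pdiff c G p ->
  mx_along c u (fun q => F q *m G q) p
  = mx_along c u F p *m G p + F p *m mx_along c u G p.
Proof.
move=> cp dF dG; apply/matrixP => i j; rewrite !mxE -big_split /=.
have -> : (fun q => (F q *m G q) i j) = (fun q => \sum_k F q i k * G q k j).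
  by apply/funext => q; rewrite mxE.
rewrite along_sum => [|k]; last exact: pdiffM.
by apply: eq_bigr => k _; rewrite alongM // !mxE.
Qed.

Lemma along_trace (R : realType) (n : nat) (M : topologicalType)
    (c : chart R n M) (u : 'cV[R]_n) (m : nat) (F : M -> 'M[R]_m) (p : M) :
  mx_pdiff c F p -> along c u (fun q => \tr (F q)) p = \tr (mx_along c u F p).
Proof.
move=> dF; rewrite along_sum //.
by apply: eq_bigr => i _; rewrite mxE.
Qed.

(** The Jacobi formula.  Differentiating the Leibniz expansion factor by factor
replaces one row of [F] at a time by its derivative; the expansion of each of
these determinants along the replaced row is a diagonal entry of
[F' *m \adj F]. *)
Lemma along_det (R : realType) (n : nat) (M : topologicalType)
    (c : chart R n M) (u : 'cV[R]_n) (m : nat) (F : M -> 'M[R]_m) (p : M) :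
  dom c p -> mx_pdiff c F p ->
  along c u (fun q => \det (F q)) p = \tr (mx_along c u F p *m \adj (F p)).
Proof.
move=> cp dF; rewrite along_sum; last first.
  by move=> s; apply: pdiffM; [exact: pdiff_cst | exact: pdiff_prod].
pose G k := \matrix_(i, j) (if i == k then mx_along c u F p i j else F p i j).
transitivity (\sum_k \det (G k)); last first.
  apply: eq_bigr => k _; rewrite (expand_det_row _ k) mxE.
  apply: eq_bigr => j _; rewrite [G k k j]mxE eqxx [\adj _ _ _]mxE.
  congr (_ * (_ * \det _)); apply/matrixP => i l.
  by rewrite !mxE eq_sym (negbTE (neq_lift _ _)).
rewrite /determinant [RHS]exchange_big /=.
apply: eq_bigr => s _ /=.
rewrite alongM //; [|exact: pdiff_cst|exact: pdiff_prod].
rewrite along_cst mul0r add0r along_prod ?index_enum_uniq // mulr_sumr.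
apply: eq_bigr => k _; congr (_ * _); apply: eq_bigr => i _.
by rewrite !mxE.
Qed.

(** * Functions with zero partial derivatives *)

(** The mean value theorem for the restriction of [G] to the segment, whose
difference quotients are those of [G] in the direction [v]. *)
Lemma constant_on_segment (R : realType) (V : normedModType R) (G : V -> R)
    (x v : V) (s : R) :
  0 <= s ->
  (forall t, 0 <= t <= s -> derivable G (x + t *: v) v) ->
  (forall t, 0 <= t <= s -> 'D_v G (x + t *: v) = 0) ->
  G (x + s *: v) = G x.
Proof.
move=> s0 dG dG0; pose h t := G (x + t *: v).
have quotE t : (fun e => e^-1 *: ((h \o shift t) (e *: 1) - h t))
             = (fun e => e^-1 *: ((G \o shift (x + t *: v)) (e *: v)
                                  - G (x + t *: v))).
  apply/funext => e; rewrite /h /=; congr (_ *: (G _ - _)).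
  by rewrite [e *: 1]mulr1 scalerDl addrCA.
have dh t : 0 <= t <= s -> derivable h t 1.
  by move=> ts; rewrite /derivable quotE; exact: dG.
have dh0 t : 0 <= t <= s -> is_derive t 1 h 0.
  move=> ts; apply: DeriveDef; first exact: dh.
  by rewrite /derive quotE; exact: dG0.
have [||t _] := @MVT_segment R h (fun=> 0) 0 s s0.
- move=> t; rewrite in_itv /= => /andP[/ltW t0 /ltW ts]; apply: dh0.
  by rewrite t0.
- apply: derivable_within_continuous => t.
  by rewrite in_itv /=; exact: dh.
by rewrite mul0r /h scale0r addr0 => /eqP; rewrite subr_eq0 => /eqP.
Qed.

Lemma ball_rVP (R : realType) (n : nat) (x y : 'rV[R]_n) (e : R) :
  0 < e -> ball x e y <-> forall i, `|x 0 i - y 0 i| < e.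
Proof.
move=> e0; split.
  by move=> [_ bxy] i; exact: bxy.
by move=> bxy; split=> // i j; rewrite ord1; exact: bxy.
Qed.

(** Only partial derivatives are available, so [x] is joined to [y] by changing
one coordinate at a time; the intermediate points stay in the ball because it
is a cube. *)
Lemma constant_on_ball (R : realType) (n : nat) (G : 'rV[R]_n -> R)
    (x y : 'rV[R]_n) (e : R) :
  0 < e ->
  (forall z, ball x e z -> forall k : 'I_n, derivable G z (delta_mx 0 k)) ->
  (forall z, ball x e z -> forall k : 'I_n, 'D_(delta_mx 0 k) G z = 0) ->
  ball x e y -> G y = G x.
Proof.
move=> e0 dG dG0 /(ball_rVP _ _ e0) bxy.
(* The point with the first [m] coordinates of [y] and the others of [x]. *)
pose w m : 'rV[R]_n := \row_i (if (i < m)%N then y 0 i else x 0 i).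
have w0 : w 0%N = x by apply/rowP => i; rewrite mxE.
have wn : w n = y by apply/rowP => i; rewrite mxE ltn_ord.
suff Gw m : (m <= n)%N -> G (w m) = G x by rewrite -wn; exact: Gw.
elim: m => [|m IHm] mn; first by rewrite w0.
rewrite -(IHm (ltnW mn)); pose k := Ordinal mn; pose s := y 0 k - x 0 k.
have wS : w m.+1 = w m + s *: delta_mx 0 k.
  apply/rowP => i; rewrite !mxE eqxx /= ltnS leq_eqVlt.
  have -> : (nat_of_ord i == m) = (i == k) by [].
  case: eqP => [->|_] /=; last by rewrite mulr0 addr0.
  by rewrite ltnn mulr1 /s addrC subrK.
have bw t : `|t| <= `|s| -> (0 <= t * s) -> ball x e (w m + t *: delta_mx 0 k).
  move=> ts ts0; apply/ball_rVP => // i; rewrite !mxE eqxx /=.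
  case: (ltnP i m) => im.
    have -> : (i == k) = false by apply/eqP => ik; rewrite ik ltnn in im.
    by rewrite mulr0 addr0.
  rewrite opprD addrA subrr sub0r normrN.
  case: eqP => [_|_]; last by rewrite mulr0 normr0.
  by rewrite mulr1 (le_lt_trans ts) // /s -normrN opprB.
rewrite wS; have [s0|s0] := leP 0 s.
  have bt t : 0 <= t <= s -> ball x e (w m + t *: delta_mx 0 k).
    by move=> /andP[t0 ts]; apply: bw; rewrite ?mulr_ge0 // !ger0_norm.
  by apply: constant_on_segment => // t /bt ?; [exact: dG|exact: dG0].
have bt t : 0 <= t <= - s ->
    ball x e (w m + s *: delta_mx 0 k + t *: delta_mx 0 k).
  move=> /andP[t0 ts]; rewrite -addrA -scalerDl; apply: bw.
    by rewrite !ler0_norm; lra.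
  by rewrite mulr_le0 //; lra.
(* For [s < 0] the segment is traversed from its other end. *)
rewrite -[in RHS](addrK (s *: delta_mx 0 k) (w m)) -scaleNr; apply/esym.
by apply: constant_on_segment => [|t /bt ?|t /bt ?];
  [lra|exact: dG|exact: dG0].
Qed.

Lemma near_constant (R : realType) (n : nat) (M : topologicalType)
    (c : chart R n M) (F : M -> R) (p : M) :
  (forall q, dom c q -> pdiff c F q) ->
  (forall q, dom c q -> forall k, pd c k F q = 0) ->
  dom c p -> \forall q \near p, F q = F p.
Proof.
move=> dF dF0 cp.
have /nbhs_ballP[e /= e0 be] := nbhs_image cp.
have Gp q : dom c q -> (F \o param c) (Defs.coord c q) = F q.
  by move=> cq; rewrite /= coordK.
have cq0 : \forall q \near p, dom c q.
  by apply: open_nbhs_nbhs; split; [exact: dom_open|].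
have bq : \forall q \near p, ball (Defs.coord c p) e (Defs.coord c q).
  by apply: (Defs.coord_continuous cp); exact: nbhsx_ballx.
near=> q; have cq : dom c q by near: q.
rewrite -(Gp q) // -(Gp p) //; apply: (@constant_on_ball _ _ _ _ _ e) => //.
- by move=> z /be[r cr <-] k; exact: dF.
- by move=> z /be[r cr <-] k; exact: dF0.
- by near: q.
Unshelve. all: by end_near.
Qed.

(** * The covariant derivative in matrix form *)

Lemma symmetric02_tr (R : realType) (n : nat) (Q : manifold R n)
    (g : tensor02 Q) (a : ix Q) (p : Q) :
  symmetric02 g -> at_chart a p -> (g a p)^T = g a p.
Proof.
move=> g_sym ap; apply: bilinear_eq => x y.
have := g_sym a p ap y x; rewrite /pairing => <-.
by rewrite -[y^T *m _ *m x]mx11_tr !trmx_mul trmxK mulmxA.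
Qed.

Definition christoffel_mx (R : realType) (n : nat) (Q : manifold R n)
    (g : tensor02 Q) (a : ix Q) (p : Q) (u : 'cV[R]_n) : 'M[R]_n :=
  \matrix_(i, l) \sum_k u k 0 * christoffel g a p i k l.

Lemma christoffel_sym (R : realType) (n : nat) (Q : manifold R n)
    (g : tensor02 Q) (a : ix Q) (p : Q) (i j k : 'I_n) :
  symmetric02 g -> at_chart a p ->
  christoffel g a p i j k = christoffel g a p i k j.
Proof.
move=> g_sym ap; congr (_ * _); apply: eq_bigr => l _; congr (_ * _).
have -> : partial a l (fun q => g a q j k) p
          = partial a l (fun q => g a q k j) p.
  apply: pd_local => // q aq.
  by rewrite -[in LHS](symmetric02_tr g_sym aq) mxE.
by rewrite [X in X - _]addrC.
Qed.

(** The Levi-Civita connection is torsion-free. *)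
Lemma christoffel_mx_sym (R : realType) (n : nat) (Q : manifold R n)
    (g : tensor02 Q) (a : ix Q) (p : Q) (u v : 'cV[R]_n) :
  symmetric02 g -> at_chart a p ->
  christoffel_mx g a p u *m v = christoffel_mx g a p v *m u.
Proof.
move=> g_sym ap; apply/colP => i; rewrite !mxE.
under eq_bigr do rewrite mxE mulr_suml.
under [RHS]eq_bigr do rewrite mxE mulr_suml.
rewrite exchange_big; apply: eq_bigr => k _; apply: eq_bigr => l _ /=.
by rewrite (christoffel_sym i k l g_sym ap); ring.
Qed.

Lemma nablaE (R : realType) (n : nat) (Q : manifold R n) (g : tensor02 Q)
    (J : tensor11 Q) (a : ix Q) (p : Q) (u : 'cV[R]_n) :
  dynamical_covariant_derivative g J a p u
  = mx_along (atlas a) u (J a) p + christoffel_mx g a p u *m J a p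
    - J a p *m christoffel_mx g a p u.
Proof.
apply/matrixP => i j; rewrite !mxE.
under eq_bigr do rewrite mxE mulrBl mulrDl.
rewrite big_split sumrN big_split /=; congr (_ + _ - _).
- by apply: eq_bigr => k _; rewrite mulrC.
- under eq_bigr do rewrite mulr_suml.
  rewrite exchange_big; apply: eq_bigr => l _; rewrite mxE mulr_suml.
  by apply: eq_bigr => k _; ring.
- under eq_bigr do rewrite mulr_suml.
  rewrite exchange_big; apply: eq_bigr => l _; rewrite mxE mulr_sumr.
  by apply: eq_bigr => k _; ring.
Qed.

Lemma covariant_derivative_alongE (R : realType) (n : nat) (Q : manifold R n)
    (g : tensor02 Q) (X : vector_field Q) (A : tensor11 Q) (a : ix Q) (p : Q) :
  covariant_derivative_along g X A a p
  = dynamical_covariant_derivative g A a p (X a p).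
Proof.
apply/matrixP => i j; rewrite summxE mxE; apply: eq_bigr => k _.
by rewrite mxE mulrC.
Qed.

Lemma t11_pdiff (R : realType) (n : nat) (Q : manifold R n) (J : tensor11 Q)
    (a : ix Q) (p : Q) :
  at_chart a p -> mx_pdiff (atlas a) (J a) p.
Proof. by move=> ap i j; exact: smooth_on_pdiff (t11_smooth J a i j) ap. Qed.

Lemma vf_pdiff (R : realType) (n : nat) (Q : manifold R n)
    (X : vector_field Q) (a : ix Q) (p : Q) :
  at_chart a p -> mx_pdiff (atlas a) (X a) p.
Proof.
by move=> ap i j; rewrite ord1; exact: smooth_on_pdiff (vf_smooth X a i) ap.
Qed.

(** The connection enters through a commutator, which has trace zero. *)
Lemma trace_nabla (R : realType) (n : nat) (Q : manifold R n)
    (g : tensor02 Q) (J : tensor11 Q) (a : ix Q) (p : Q) (u : 'cV[R]_n) :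
  at_chart a p ->
  \tr (dynamical_covariant_derivative g J a p u)
  = along (atlas a) u (fun q => \tr (J a q)) p.
Proof.
move=> ap; rewrite along_trace; last exact: t11_pdiff.
by rewrite nablaE mxtraceD mxtraceD raddfN /= [X in _ - X]mxtrace_mulC addrK.
Qed.

(** The covariant form of the derivative of [J A = (det J) I].  The derivative of
[det J] is [tr (D_u J A)] as [A] is the adjugate of the invertible [J]; it is
also [tr (nabla_u J A)], because [J A] and [A J] are scalar and the connection
terms cancel.  For the same reason the connection terms cancel in the product
rule itself. *)
Lemma nabla_cofactor (R : realType) (n : nat) (Q : manifold R n)
    (g : tensor02 Q) (J A : tensor11 Q) (a : ix Q) (p : Q) (u : 'cV[R]_n) :
  nonsingular J -> is_cofactor J A -> at_chart a p ->
  let N := dynamical_covariant_derivative g J a p u in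
  J a p *m dynamical_covariant_derivative g A a p u
  = (\tr (N *m A a p))%:M - N *m A a p.
Proof.
move=> J_ns JA ap N.
have AJ : A a p *m J a p = (\det (J a p))%:M.
  rewrite -[A a p](mulKmx (J_ns a p ap)) JA // mul_mx_scalar -scalemxAl.
  by rewrite mulVmx ?J_ns // scalemx1.
have adjA : \adj (J a p) = A a p.
  rewrite -[A a p](mulKmx (J_ns a p ap)) JA //.
  by rewrite -mul_mx_adj mulKmx ?J_ns.
pose d := along (atlas a) u (fun q => \det (J a q)) p.
have dE : d = \tr (mx_along (atlas a) u (J a) p *m A a p).
  by rewrite /d along_det // ?adjA //; exact: t11_pdiff.
have leibniz : mx_along (atlas a) u (J a) p *m A a p
    + J a p *m mx_along (atlas a) u (A a) p = d%:M.
  rewrite -mx_alongM //; [|exact: t11_pdiff|exact: t11_pdiff].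
  rewrite (@mx_along_local _ _ _ _ _ _ _ _ (fun q => (\det (J a q))%:M))
    //; last exact: JA.
  apply/matrixP => i j; rewrite mxE [RHS]mxE.
  under [fun q => _]funext do rewrite mxE.
  by case: eqP => _ //; exact: along_cst.
have trN : \tr (N *m A a p) = d.
  rewrite /N nablaE !mulmxDl mulNmx !mxtraceD raddfN /= -dE.
  rewrite -!mulmxA JA // [X in _ - X]mxtrace_mulC -mulmxA AJ.
  by rewrite addrK.
rewrite trN -leibniz /N !nablaE.
rewrite !(mulmxDr, mulmxDl, mulmxN, mulNmx) !mulmxA JA //.
rewrite -[christoffel_mx _ _ _ _ *m _ *m _]mulmxA JA // scalar_mxC.
apply/matrixP => i j; rewrite !(addmxE, oppmxE); ring.
Qed.

(** The law [D^T g_b D = g_a] for the components of a nonsingular [g] forces the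
Jacobian [D] to be invertible; this avoids the chain rule for the two changes
of charts. *)
Lemma jacobian_unit (R : realType) (n : nat) (Q : manifold R n)
    (g : tensor02 Q) (a b : ix Q) (p : Q) :
  nonsingular g -> at_chart a p -> at_chart b p ->
  Defs.jacobian a b p \in unitmx.
Proof.
move=> g_ns ap bp; have := g_ns a p ap.
by rewrite -(t02_change g ap bp) unitmx_mul => /andP[].
Qed.

Lemma trace_chart (R : realType) (n : nat) (Q : manifold R n)
    (g : tensor02 Q) (J : tensor11 Q) (a b : ix Q) (p : Q) :
  nonsingular g -> at_chart a p -> at_chart b p -> \tr (J b p) = \tr (J a p).
Proof.
move=> g_ns ap bp; have Du := jacobian_unit g_ns ap bp.
rewrite -[J b p](mulmxK Du) (t11_change J ap bp) mxtrace_mulC mulmxA.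
by rewrite mulVmx // mul1mx.
Qed.

(** * The Nijenhuis torsion *)

Lemma lie_bracketE (R : realType) (n : nat) (Q : manifold R n)
    (X Y : vcomp Q) (a : ix Q) (p : Q) :
  lie_bracket X Y a p
  = mx_along (atlas a) (X a p) (Y a) p - mx_along (atlas a) (Y a p) (X a) p.
Proof. by apply/colP => i; rewrite !mxE -sumrB. Qed.

(** The torsion is a tensor: the derivatives of [X] and [Y] drop out. *)
Lemma nijenhuis_along (R : realType) (n : nat) (Q : manifold R n)
    (J : tensor11 Q) (X Y : vector_field Q) (a : ix Q) (p : Q) :
  at_chart a p ->
  let D u := mx_along (atlas a) u (J a) p in
  nijenhuis J X Y a p
  = D (J a p *m X a p) *m Y a p - D (J a p *m Y a p) *m X a p
    + J a p *m (D (Y a p) *m X a p - D (X a p) *m Y a p).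
Proof.
move=> ap D; rewrite /nijenhuis /vsub /vadd /apply11 !lie_bracketE.
have DJ u (Z : vector_field Q) :
    mx_along (atlas a) u (fun q => J a q *m Z a q) p
    = D u *m Z a p + J a p *m mx_along (atlas a) u (Z a) p.
  by rewrite mx_alongM //; [exact: t11_pdiff | exact: vf_pdiff].
rewrite !DJ !mulmxDr !mulmxN !mulmxDr.
by apply/colP => i; rewrite !(addmxE, oppmxE); ring.
Qed.

(** The connection terms produced by the replacement of derivatives by covariant
derivatives cancel in pairs, by [christoffel_mx_sym]. *)
Lemma nijenhuis_nabla (R : realType) (n : nat) (Q : manifold R n)
    (g : tensor02 Q) (J : tensor11 Q) (X Y : vector_field Q) (a : ix Q)
    (p : Q) :
  symmetric02 g -> at_chart a p ->
  let N u := dynamical_covariant_derivative g J a p u in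
  nijenhuis J X Y a p
  = N (J a p *m X a p) *m Y a p - N (J a p *m Y a p) *m X a p
    + J a p *m (N (Y a p) *m X a p - N (X a p) *m Y a p).
Proof.
move=> g_sym ap N; rewrite nijenhuis_along //.
pose G u := christoffel_mx g a p u.
have GC u v : G u *m v = G v *m u by exact: christoffel_mx_sym.
have NE u v : N u *m v = mx_along (atlas a) u (J a) p *m v
    + G u *m (J a p *m v) - J a p *m (G u *m v).
  by rewrite /N nablaE !mulmxDl mulNmx -!mulmxA.
rewrite !NE [G (J a p *m X a p) *m (J a p *m _)]GC.
rewrite [G (J a p *m X a p) *m Y a p]GC [G (J a p *m Y a p) *m X a p]GC.
rewrite [G (Y a p) *m X a p]GC !mulmxDr !mulmxN !mulmxDr.
by apply/colP => i; rewrite !(addmxE, oppmxE, mulmxN); ring.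
Qed.

(** * Special conformal Killing tensors *)

Lemma alongE (R : realType) (n : nat) (Q : manifold R n) (a : ix Q)
    (u : 'cV[R]_n) (F : Q -> R) (p : Q) :
  along (atlas a) u F p = (dH F a p *m u) 0 0.
Proof. by rewrite mxE; apply: eq_bigr => k _; rewrite mxE mulrC. Qed.

(** A symmetric [J] with this property is known as a special conformal Killing
tensor, or Benenti tensor. *)
Definition special_conformal_killing (R : realType) (n : nat) (Q : manifold R n)
    (g : tensor02 Q) (J : tensor11 Q) (f : Q -> R) (Z : vector_field Q) :=
  forall (a : ix Q) (p : Q), at_chart a p -> forall u : 'cV[R]_n,
     dynamical_covariant_derivative g J a p u =
     2^-1 *: (tensor_product (canonical_vector u) (dH f a p)
              - tensor_product (Z a p) (theta g a p u)).

Lemma special_nabla_apply (R : realType) (n : nat) (Q : manifold R n)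
    (g : tensor02 Q) (J : tensor11 Q) (f : Q -> R) (Z : vector_field Q)
    (a : ix Q) (p : Q) (u v : 'cV[R]_n) :
  special_conformal_killing g J f Z -> at_chart a p ->
  dynamical_covariant_derivative g J a p u *m v
  = 2^-1 *: ((dH f a p *m v) 0 0 *: u - pairing g a p u v *: Z a p).
Proof.
move=> J_eq ap; rewrite J_eq // /tensor_product /theta /canonical_vector.
rewrite -scalemxAl mulmxBl -!mulmxA /pairing -mulmxA.
rewrite {1}[dH f a p *m v]mx11_scalar {1}[u^T *m _]mx11_scalar.
by rewrite !mul_mx_scalar.
Qed.

Lemma special_nijenhuis0 (R : realType) (n : nat) (Q : manifold R n)
    (g : tensor02 Q) (J : tensor11 Q) (f : Q -> R) (Z : vector_field Q)
    (X Y : vector_field Q) (a : ix Q) (p : Q) :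
  symmetric02 g -> g_symmetric g J -> special_conformal_killing g J f Z ->
  at_chart a p -> nijenhuis J X Y a p = 0.
Proof.
move=> g_sym J_sym J_eq ap; rewrite (nijenhuis_nabla _ _ _ g_sym ap).
rewrite !(special_nabla_apply _ _ J_eq ap) (J_sym a p ap).
rewrite [pairing g a p (X a p) (J a p *m _)]g_sym //.
rewrite [pairing g a p (X a p) (Y a p)]g_sym //.
rewrite !(mulmxBr, =^~ scalemxAr).
by apply/colP => i; rewrite !(addmxE, oppmxE, scalemxE) [RHS]mxE; ring.
Qed.

Lemma special_along_trace (R : realType) (n : nat) (Q : manifold R n)
    (g : tensor02 Q) (J : tensor11 Q) (f : Q -> R) (Z : vector_field Q)
    (a : ix Q) (p : Q) (u : 'cV[R]_n) :
  symmetric02 g -> is_X_of g f Z -> special_conformal_killing g J f Z ->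
  at_chart a p ->
  along (atlas a) u (fun q => \tr (J a q)) p = along (atlas a) u f p.
Proof.
move=> g_sym Z_def J_eq ap; rewrite -(trace_nabla g) // J_eq //.
rewrite mxtraceZ raddfB /= /tensor_product /theta /canonical_vector.
(* Both traces are traces of rank one matrices, hence 1 x 1 products. *)
rewrite mxtrace_mulC [X in _ - X]mxtrace_mulC /mxtrace !big_ord1 alongE.
have -> : (u^T *m g a p *m Z a p) 0 0 = - (dH f a p *m u) 0 0.
  by have := Z_def a p ap u; rewrite -(g_sym a p ap).
by field.
Qed.

(** The function [f - tr J] is well defined on the manifold although [tr J] is
computed in a chart: [trace_chart] makes the choice of a chart at each point
irrelevant. *)
Lemma special_trace (R : realType) (n : nat) (Q : manifold R n)
    (g : tensor02 Q) (J : tensor11 Q) (f : Q -> R) (Z : vector_field Q) :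
  symmetric02 g -> nonsingular g -> smooth_function f -> is_X_of g f Z ->
  special_conformal_killing g J f Z ->
  exists2 c : Q -> R, locally_constant c &
    forall (a : ix Q) (p : Q), at_chart a p -> f p = \tr (J a p) + c p.
Proof.
move=> g_sym g_ns f_smooth Z_def J_eq.
pose chart_of (p : Q) := sval (cid (atlas_cover p)).
have chart_ofP p : at_chart (chart_of p) p by rewrite /chart_of; case: cid.
have trE a p : at_chart a p -> \tr (J (chart_of p) p) = \tr (J a p).
  by move=> ap; exact: (trace_chart _ g_ns ap (chart_ofP p)).
exists (fun p => f p - \tr (J (chart_of p) p)); last first.
  by move=> a p ap; rewrite (trE a) // addrC subrK.
move=> p; have cp := chart_ofP p; set a := chart_of p in cp *.
pose F q := f q + -1 * \tr (J a q).
have df q : at_chart a q -> pdiff (atlas a) f q.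
  exact: smooth_on_pdiff (f_smooth a).
have dtr q : at_chart a q -> pdiff (atlas a) (fun r => \tr (J a r)) q.
  by move=> aq; apply: pdiff_sum => i; exact: t11_pdiff.
have dNtr q : at_chart a q -> pdiff (atlas a) (fun r => -1 * \tr (J a r)) q.
  by move=> aq; apply: pdiffM; [exact: pdiff_cst | exact: dtr].
have aq : \forall q \near p, at_chart a q.
  by apply: open_nbhs_nbhs; split; [exact: dom_open|].
have F0 u q : at_chart a q -> along (atlas a) u F q = 0.
  move=> bq; rewrite (alongD u (df q bq) (dNtr q bq)).
  rewrite (alongM u bq (@pdiff_cst R n Q (atlas a) (-1) q) (dtr q bq)).
  rewrite along_cst mul0r add0r.
  by rewrite (special_along_trace u g_sym Z_def J_eq bq) mulN1r subrr.
have Fq : \forall q \near p, F q = F p.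
  apply: (near_constant (c := atlas a) (F := F)); last exact: cp.
    by move=> q bq; apply: pdiffD; [exact: df | exact: dNtr].
  by move=> q bq k; rewrite -along_delta F0.
(* The chart chosen at [q] may differ from the chart [a] chosen at [p]. *)
apply: filterS2 aq Fq => q bq; rewrite /F !mulN1r => Fqp.
by rewrite (trE a) // Fqp.
Qed.

(** As [A = (det J) J^-1], everything is expressed by the symmetric form
[h(x, y) = g(J^-1 x, y)] and the form [psi(x) = df (J^-1 x)]; the two minus one
half coefficients of [termE] balance the coefficient one in the cyclic sum. *)
Lemma special_cofactor_killing (R : realType) (n : nat) (Q : manifold R n)
    (g : tensor02 Q) (J : tensor11 Q) (f : Q -> R) (Xf : vector_field Q)
    (A : tensor11 Q) :
  symmetric02 g -> g_symmetric g J -> is_X_of g f Xf ->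
  special_conformal_killing g J f Xf -> nonsingular J -> is_cofactor J A ->
  is_killing g A.
Proof.
move=> g_sym J_sym Xf_def J_eq J_ns JA X Y Z a p ap term.
pose K := invmx (J a p); pose delta := \det (J a p).
pose h (x y : 'cV[R]_n) : R := pairing g a p (K *m x) y.
pose psi (x : 'cV[R]_n) : R := (dH f a p *m (K *m x)) 0 0.
have JK (x : 'cV[R]_n) : J a p *m (K *m x) = x.
  by rewrite mulmxA mulmxV ?J_ns // mul1mx.
have AE : A a p = delta *: K.
  by rewrite -[A a p](mulKmx (J_ns a p ap)) JA // mul_mx_scalar.
have hC x y : h x y = h y x.
  rewrite /h -{1}[y]JK -(J_sym a p ap) JK; exact: g_sym.
have hXf y : h (Xf a p) y = - psi y.
  by rewrite hC /h (g_sym a p ap) (Xf_def a p ap).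
have pairD x y z :
    pairing g a p (x + y) z = pairing g a p x z + pairing g a p y z.
  by rewrite /pairing linearD /= !mulmxDl addmxE.
have pairZ s x y : pairing g a p (s *: x) y = s * pairing g a p x y.
  by rewrite /pairing linearZ /= -!scalemxAl scalemxE.
have pairN x y : pairing g a p (- x) y = - pairing g a p x y.
  by rewrite /pairing linearN /= !mulNmx oppmxE.
have termE (U V T : vector_field Q) : term U V T
    = delta * (psi (U a p) * h (V a p) (T a p)
               - 2^-1 * psi (V a p) * h (U a p) (T a p)
               - 2^-1 * psi (T a p) * h (U a p) (V a p)).
  rewrite /term covariant_derivative_alongE.
  set u := U a p; set v := V a p; set w := T a p.
  pose N := dynamical_covariant_derivative g J a p u.
  have NA x : N *m A a p *m x
      = 2^-1 *: (delta *: (psi x *: u - h u x *: Xf a p)).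
    rewrite -mulmxA AE -scalemxAl (special_nabla_apply _ _ J_eq ap).
    rewrite -scalemxAr scalemxE g_sym // pairZ -/(h x u) hC -/(psi x).
    by rewrite !scalerBr !scalerA !mulrA.
  have trNA : \tr (N *m A a p) = delta * psi u.
    rewrite /N J_eq // /tensor_product /theta /canonical_vector.
    rewrite -scalemxAl mulmxBl -!mulmxA mxtraceZ raddfB /=.
    rewrite mxtrace_mulC [X in _ - X]mxtrace_mulC /mxtrace !big_ord1.
    have -> : (dH f a p *m A a p *m u) 0 0 = delta * psi u.
      by rewrite -mulmxA AE -scalemxAl -scalemxAr scalemxE.
    have -> : (u^T *m (g a p *m A a p) *m Xf a p) 0 0 = - (delta * psi u).
      rewrite -!mulmxA AE -scalemxAl -!scalemxAr scalemxE mulmxA.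
      by rewrite -/(pairing g a p u (K *m Xf a p)) g_sym // -/(h _ _) hXf mulrN.
    by field.
  have -> : dynamical_covariant_derivative g A a p u
      = K *m (J a p *m dynamical_covariant_derivative g A a p u).
    by rewrite mulKmx ?J_ns.
  rewrite nabla_cofactor // -/N trNA -mulmxA mulmxBl mul_scalar_mx NA.
  rewrite !(mulmxBr, =^~ scalemxAr) !(pairD, pairN, pairZ).
  by rewrite -/(h v w) -/(h u w) -/(h (Xf a p) w) hXf; ring.
rewrite !termE (hC (Y a p) (X a p)) (hC (Z a p) (X a p)) (hC (Z a p) (Y a p)).
by field.
Qed.

Theorem theorem2 (R : realType) (n : nat) (Q : manifold R n)
  (g : tensor02 Q) (J : tensor11 Q) (f : Q -> R) (Xf : vector_field Q)
  (g_sym : symmetric02 g)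
  (g_nonsingular : nonsingular g)
  (J_sym : g_symmetric g J)
  (f_smooth : smooth_function f)
  (Xf_def : is_X_of g f Xf)
  (J_eq : forall (a : ix Q) (p : Q), at_chart a p -> forall u : 'cV[R]_n,
     dynamical_covariant_derivative g J a p u =
     2^-1 *: (tensor_product (canonical_vector u) (dH f a p)
              - tensor_product (Xf a p) (theta g a p u))) :
  [/\ (forall (X Y : vector_field Q) (a : ix Q) (p : Q), at_chart a p ->
         nijenhuis J X Y a p = 0),
      (exists2 c : Q -> R, locally_constant c &
         forall (a : ix Q) (p : Q), at_chart a p -> f p = \tr (J a p) + c p)
    & (nonsingular J -> forall A : tensor11 Q, is_cofactor J A ->
         is_killing g A)].
Proof.
split.
- by move=> X Y a p; exact: (special_nijenhuis0 X Y g_sym J_sym J_eq).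
- exact: (special_trace g_sym g_nonsingular f_smooth Xf_def J_eq).
- move=> J_ns A JA.
  exact: (special_cofactor_killing g_sym J_sym Xf_def J_eq J_ns JA).
Qed.
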